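(* Let $H$ be a finite-dimensional Hopf algebra over a field $k$ with a pivotal element $g_{\mathrm{piv}}\in H$. For a finite-dimensional right $H$-comodule algebra $A$, there is a bijection between the following two spaces: (1) the space of right modified traces on $A\text{-proj}$; (2) the space of all linear maps $\lambda:A\to k$ satisfying $\lambda(ab)=\lambda(ba)$ and $\lambda(a_{(0)})a_{(1)}=\lambda(a)g_{\mathrm{piv}}^{-1}$ for all $a,b\in A$.
   Context: A pivotal element of $H$ (with antipode $S$) is a grouplike element $g$ with $S^2(h)=ghg^{-1}$ for all $h\in H$. $A\text{-mod}$ and $\mathcal{C}=H\text{-mod}$ are categories of finite-dimensional left modules; $A\text{-proj}$ is the full subcategory of projective objects of $A\text{-mod}$. A right $H$-comodule algebra is an algebra $A$ with a right $H$-coaction $\delta_A(a)=a_{(0)}\otimes a_{(1)}$ that is a unital algebra map $A\to A\otimes_kH$. $A\text{-mod}$ is a right $\mathcal{C}$-module category by $M\triangleleft X=M\otimes_kX$, $a(m\otimes x)=a_{(0)}m\otimes a_{(1)}x$. The left dual of $X\in\mathcal{C}$ is $X^*=\mathrm{Hom}_k(X,k)$ with $\langle hx^*,x\rangle=\langle x^*,S(h)x\rangle$ and the usual $\mathrm{ev}_X:X^*\otimes X\to k$, $\mathrm{coev}_X:k\to X\otimes X^*$. The pivotal structure of $\mathcal{C}$ is $\mathfrak{p}_X:X\to X^{**}$, $\langle\mathfrak{p}_X(x),x^*\rangle=\langle x^*,g_{\mathrm{piv}}x\rangle$. A right modified trace on $A\text{-proj}$ is a family of $k$-linear maps $\mathtt{t}_P:\mathrm{Hom}_A(P,P)\to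 k$ ($P\in A\text{-proj}$) such that $\mathtt{t}_P(gf)=\mathtt{t}_Q(fg)$ for all $f:P\to Q$, $g:Q\to P$ in $A\text{-proj}$, and $\mathtt{t}_P\big((\mathrm{id}_P\otimes\mathrm{ev}_{X^*})(f\otimes\mathrm{id}_{X^*})(\mathrm{id}_P\otimes\mathrm{coev}_X)\big)=\mathtt{t}_{P\triangleleft X}\big((\mathrm{id}_P\otimes\mathfrak{p}_X^{-1})\circ f\big)$ for all $P\in A\text{-proj}$, $X\in\mathcal{C}$ and $A$-linear $f:P\triangleleft X\to P\triangleleft X^{**}$. *)

(* Defs.v *)
From HB Require Import structures.
From mathcomp Require Import all_boot ssralg matrix vector falgebra boolp.
Set Implicit Arguments.
Unset Strict Implicit.
Unset Printing Implicit Defensive.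
Import GRing.Theory.
Local Open Scope ring_scope.

Reserved Notation "V \ox W" (at level 40, left associativity).
Reserved Notation "v \ot w" (at level 40, left associativity).
Reserved Notation "M <| X" (at level 40, left associativity).

Section Tensor.
Variable k : fieldType.
Implicit Types U V W X Y Z : vectType k.

(* An element of V (x) W is the matrix of its coordinates on the basis
   e_i (x) f_j, with (e_i) and (f_j) the library bases of V and W. *)
Definition tensor V W := 'M[k]_(\dim {:V}, \dim {:W}).
Local Notation "V \ox W" := (tensor V W) : type_scope.

Definition tens V W (v : V) (w : W) : V \ox W :=
  \matrix_(i, j) (coord (vbasis {:V}) i v * coord (vbasis {:W}) j w).
Local Notation "v \ot w" := (tens v w) : ring_scope.

Definition tlift_fun V W U (b : V -> W -> U) (t : V \ox W) : U :=
  \sum_i \sum_j t i j *: b (vbasis {:V})`_i (vbasis {:W})`_j.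

Fact tlift_is_linear V W U (b : V -> W -> U) : linear (tlift_fun b).
Proof.
move=> c s t; rewrite /tlift_fun scaler_sumr -big_split; apply: eq_bigr => i _.
rewrite scaler_sumr -big_split; apply: eq_bigr => j _ /=.
by rewrite !mxE scalerDl scalerA.
Qed.
HB.instance Definition _ V W U (b : V -> W -> U) :=
  GRing.isLinear.Build k (V \ox W) U *:%R (tlift_fun b) (tlift_is_linear b).

(* The linear map V (x) W -> U induced by a bilinear map; see tliftE. *)
Definition tlift V W U (b : V -> W -> U) : 'Hom(V \ox W, U) :=
  linfun (tlift_fun b).

Definition bilin V W U (b : V -> W -> U) :=
  (forall w, linear (b^~ w)) /\ (forall v, linear (b v)).

Lemma tens_bilin V W : bilin (@tens V W).
Proof.
split=> [w c u v | v c u w]; apply/matrixP => i j; rewrite !mxE linearP /=.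
  by rewrite mulrDl mulrA.
by rewrite mulrDr mulrCA.
Qed.

Lemma tensPl V W c (u v : V) (w : W) :
  (c *: u + v) \ot w = c *: (u \ot w) + v \ot w.
Proof. exact: (tens_bilin V W).1. Qed.
Lemma tensPr V W c (v : V) (u w : W) :
  v \ot (c *: u + w) = c *: (v \ot u) + v \ot w.
Proof. exact: (tens_bilin V W).2. Qed.

Lemma bilin_suml V W U (b : V -> W -> U) (hb : bilin b) n (F : 'I_n -> k)
    (G : 'I_n -> V) w :
  b (\sum_i F i *: G i) w = \sum_i F i *: b (G i) w.
Proof.
have b0 : b 0 w = 0.
  by have := hb.1 w (-1) 0 0; rewrite !scaleN1r oppr0 addr0 addNr.
elim: n F G => [|n IH] F G; first by rewrite !big_ord0.
by rewrite !big_ord_recl /= hb.1 IH.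
Qed.
Lemma bilin_sumr V W U (b : V -> W -> U) (hb : bilin b) n (F : 'I_n -> k)
    (G : 'I_n -> W) v :
  b v (\sum_i F i *: G i) = \sum_i F i *: b v (G i).
Proof.
have b0 : b v 0 = 0.
  by have := hb.2 v (-1) 0 0; rewrite !scaleN1r oppr0 addr0 addNr.
elim: n F G => [|n IH] F G; first by rewrite !big_ord0.
by rewrite !big_ord_recl /= hb.2 IH.
Qed.

Lemma tliftE V W U (b : V -> W -> U) (hb : bilin b) v w :
  tlift b (v \ot w) = b v w.
Proof.
rewrite lfunE /= /tlift_fun.
rewrite [in RHS](coord_vbasis (memvf v)) (bilin_suml hb).
apply: eq_bigr => i _.
rewrite [in RHS](coord_vbasis (memvf w)) (bilin_sumr hb) scaler_sumr.
by apply: eq_bigr => j _; rewrite mxE scalerA.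
Qed.

Lemma coord_vbasisE V (i j : 'I_(\dim {:V})) :
  coord (vbasis {:V}) i (vbasis {:V})`_j = (i == j)%:R.
Proof. by rewrite coord_free ?(basis_free (vbasisP _)) // eq_sym. Qed.

Lemma tensor_ind V W (P : V \ox W -> Prop) :
  (forall v w, P (v \ot w)) ->
  (forall c s t, P s -> P t -> P (c *: s + t)) -> forall t, P t.
Proof.
move=> P1 P2 t.
have P0 : P 0.
  by have := P2 (-1) _ _ (P1 0 0) (P1 0 0); rewrite scaleN1r addNr.
have -> : t = \sum_i \sum_j t i j *: ((vbasis {:V})`_i \ot (vbasis {:W})`_j).
  apply/matrixP => a b; rewrite summxE (bigD1 a) //= summxE (bigD1 b) //=.
  rewrite !mxE !coord_vbasisE !eqxx !mulr1.
  rewrite big1 ?addr0 => [|j jb]; last first.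
    by rewrite !mxE !coord_vbasisE [b == j]eq_sym (negPf jb) !mulr0.
  rewrite big1 ?addr0 // => i ia; rewrite summxE big1 // => j _.
  by rewrite !mxE !coord_vbasisE [a == i]eq_sym (negPf ia) mul0r mulr0.
elim/big_rec: _ => // i s _ Ps; elim/big_rec: _ => [|j s' _ Ps']; first by rewrite add0r.
by rewrite -addrA; apply: P2.
Qed.

Lemma lfun_tensP V W U (f g : 'Hom(V \ox W, U)) :
  (forall v w, f (v \ot w) = g (v \ot w)) -> f = g.
Proof.
move=> fg; apply/lfunP; elim/tensor_ind => // c s t fs ft.
by rewrite !linearP /= fs ft.
Qed.

Lemma eq_tlift V W U (b b' : V -> W -> U) t :
  (forall v w, b v w = b' v w) -> tlift b t = tlift b' t.
Proof.
move=> bb; rewrite !lfunE; apply: eq_bigr => i _; apply: eq_bigr => j _.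
by rewrite bb.
Qed.

Lemma tlift_comp V W U U' (f : {linear U -> U'}) (b : V -> W -> U) t :
  f (tlift b t) = tlift (fun v w => f (b v w)) t.
Proof.
rewrite !lfunE /= /tlift_fun linear_sum; apply: eq_bigr => i _.
by rewrite linear_sum; apply: eq_bigr => j _; rewrite linearZ.
Qed.

Lemma tliftP V W U (b b' : V -> W -> U) c t :
  tlift (fun v w => c *: b v w + b' v w) t = c *: tlift b t + tlift b' t.
Proof.
rewrite !lfunE /= /tlift_fun scaler_sumr -big_split; apply: eq_bigr => i _.
rewrite scaler_sumr -big_split; apply: eq_bigr => j _ /=.
by rewrite scalerDr !scalerA [c * _]mulrC.
Qed.

Lemma comp_bilin V W U U' (f : 'Hom(U, U')) (b : V -> W -> U) :
  bilin b -> bilin (fun v w => f (b v w)).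
Proof. by case=> bl br; split=> [w c u v|v c u w]; rewrite ?bl ?br linearP. Qed.

Definition tmap V W V' W' (f : 'Hom(V, V')) (g : 'Hom(W, W')) :
  'Hom(V \ox W, V' \ox W') := tlift (fun v w => f v \ot g w).

Lemma tmapE V W V' W' (f : 'Hom(V, V')) (g : 'Hom(W, W')) v w :
  tmap f g (v \ot w) = f v \ot g w.
Proof.
by apply: tliftE; split=> [x c u u'|x c u u']; rewrite linearP ?tensPl ?tensPr.
Qed.

Lemma lfunPZ V W (f : 'Hom(V, W)) c u v : f (c *: u + v) = c *: f u + f v.
Proof. exact: linearP. Qed.

Lemma tmap_bilin V W V' W' : bilin (@tmap V W V' W').
Proof.
split=> [g c f f'|f c g g']; apply: lfun_tensP => v w;
by rewrite add_lfunE scale_lfunE !tmapE add_lfunE scale_lfunE ?tensPl ?tensPr.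
Qed.

Lemma tmap1 V W : tmap \1 \1 = \1%VF :> 'End(V \ox W).
Proof. by apply: lfun_tensP => v w; rewrite tmapE !lfunE. Qed.

Lemma tmap_comp V W V' W' V2 W2 (f' : 'Hom(V', V2)) (g' : 'Hom(W', W2))
    (f : 'Hom(V, V')) (g : 'Hom(W, W')) :
  tmap (f' \o f) (g' \o g) = (tmap f' g' \o tmap f g)%VF.
Proof. by apply: lfun_tensP => v w; rewrite comp_lfunE !tmapE !comp_lfunE. Qed.

Definition tassoc V W U : 'Hom((V \ox W) \ox U, V \ox (W \ox U)) :=
  tlift (fun t u => tlift (fun v w => v \ot (w \ot u)) t).
Definition tassocV V W U : 'Hom(V \ox (W \ox U), (V \ox W) \ox U) :=
  tlift (fun v t => tlift (fun w u => (v \ot w) \ot u) t).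

Lemma tassocE V W U (v : V) (w : W) (u : U) :
  tassoc V W U ((v \ot w) \ot u) = v \ot (w \ot u).
Proof.
have hb u' : bilin (fun (v : V) (w : W) => v \ot (w \ot u')).
  by split=> [x c y z|x c y z]; rewrite ?(tensPl, tensPr).
rewrite tliftE; first by rewrite tliftE.
split=> [x c y z|x c y z]; first by rewrite linearP.
by rewrite -tliftP; apply: eq_tlift => v' w'; rewrite !tensPr.
Qed.

Lemma tassocVE V W U (v : V) (w : W) (u : U) :
  tassocV V W U (v \ot (w \ot u)) = (v \ot w) \ot u.
Proof.
have hb v' : bilin (fun (w : W) (u : U) => (v' \ot w) \ot u : (V \ox W) \ox U).
  by split=> [x c y z|x c y z]; rewrite ?(tensPl, tensPr).
rewrite tliftE; first by rewrite tliftE.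
split=> [x c y z|x c y z]; last by rewrite linearP.
by rewrite -tliftP; apply: eq_tlift => w' u'; rewrite !tensPl.
Qed.

Lemma tlift_sum V W U (I : Type) (r : seq I) (c : I -> k)
    (b : I -> V -> W -> U) t :
  tlift (fun v w => \sum_(i <- r) c i *: b i v w) t =
  \sum_(i <- r) c i *: tlift (b i) t.
Proof.
elim: r => [|i r IH]; last first.
  by rewrite big_cons -IH -tliftP; apply: eq_tlift => v w; rewrite big_cons.
rewrite big_nil lfunE /= /tlift_fun big1 // => i _; rewrite big1 // => j _.
by rewrite big_nil scaler0.
Qed.

Lemma tlift_exch V W V' W' U (b : V -> W -> V' -> W' -> U) s t :
  tlift (fun v w => tlift (b v w) t) s =
  tlift (fun v' w' => tlift (fun v w => b v w v' w') s) t.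
Proof.
rewrite [LHS]lfunE /= /tlift_fun pair_bigA /=.
rewrite -(tlift_sum (index_enum _) (fun p => s p.1 p.2)
            (fun p => b (vbasis {:V})`_p.1 (vbasis {:W})`_p.2)).
by apply: eq_tlift => v' w'; rewrite lfunE /= /tlift_fun pair_bigA.
Qed.

Definition trilin V W Z U (F : V -> W -> Z -> U) :=
  (forall x, bilin (F x)) /\ (forall y z, linear (fun x => F x y z)).

Lemma tlift_assoc V W X Y Z U (t1 : V \ox Z) (t2 : X \ox W)
    (f : 'Hom(V, X \ox Y)) (g : 'Hom(W, Y \ox Z)) (F : X -> Y -> Z -> U) :
  tassoc X Y Z (tmap f \1 t1) = tmap \1 g t2 -> trilin F ->
  tlift (fun v z => tlift (fun x y => F x y z) (f v)) t1 =
  tlift (fun x w => tlift (F x) (g w)) t2.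
Proof.
move=> e [F1 F2].
pose G := tlift (fun x t => tlift (F x) t).
have GE x y z : G (x \ot (y \ot z)) = F x y z.
  rewrite tliftE ?tliftE //; split=> [w c u v|v c u w]; last by rewrite lfunPZ.
  by rewrite -tliftP; apply: eq_tlift => v' w'; rewrite F2.
have := congr1 G e.
have -> : G (tmap \1 g t2) = tlift (fun x w => tlift (F x) (g w)) t2.
  elim/tensor_ind: t2 {e} => [x w|c s t es et]; last by rewrite !lfunPZ es et.
  rewrite tmapE id_lfunE [RHS]tliftE; last first.
    split=> [w' c u v|v c u w']; last by rewrite !lfunPZ.
    by rewrite -tliftP; apply: eq_tlift => v' w''; rewrite F2.
  elim/tensor_ind: (g w) => [y z|c s t es et]; first by rewrite GE tliftE.
  by rewrite tensPr !lfunPZ es et.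
move=> <-.
elim/tensor_ind: t1 {e} => [v z|c s t es et]; last by rewrite !lfunPZ es et.
rewrite tmapE id_lfunE [LHS]tliftE; last first.
  split=> [w' c u v'|v' c u w']; first by rewrite !lfunPZ.
  by rewrite -tliftP; apply: eq_tlift => x y; rewrite (F1 x).2.
elim/tensor_ind: (f v) => [x y|c s t es et].
  rewrite tassocE GE tliftE //; split=> [w' c u v'|v' c u w'].
    exact: F2.
  exact: (F1 _).1.
by rewrite tensPl !lfunPZ es et.
Qed.

End Tensor.

Notation "V \ox W" := (tensor V W) : type_scope.
Notation "v \ot w" := (tens v w) : ring_scope.

(* Finite-dimensional unital associative algebras. Contrary to falgType, this
   structure allows the zero algebra. *)
Record fdAlg (k : fieldType) := FdAlg {
  alg_vect :> vectType k;
  alg_one : alg_vect;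
  alg_mul : alg_vect -> alg_vect -> alg_vect;
  alg_bilin : bilin alg_mul;
  alg_mulA : associative alg_mul;
  alg_mul1 : left_id alg_one alg_mul;
  alg_mulr1 : right_id alg_one alg_mul }.

Section FalgFdAlg.
Variables (k : fieldType) (A : falgType k).
Fact falg_bilin : bilin (fun a b : A => a * b).
Proof.
by split=> [b c u v|b c u v]; rewrite ?mulrDl ?mulrDr -?scalerAl -?scalerAr.
Qed.
Definition fdAlg_of_falg : fdAlg k :=
  FdAlg falg_bilin (@mulrA A) (@mul1r A) (@mulr1 A).
End FalgFdAlg.

Definition tmul (k : fieldType) (A B : fdAlg k) (s t : A \ox B) : A \ox B :=
  tlift (fun a b => tlift (fun a' b' => alg_mul a a' \ot alg_mul b b') t) s.

(* For b bilinear, tlift b (comul h) is b(h_(1), h_(2)) in Sweedler notation. *)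
Record hopfAlg (k : fieldType) := HopfAlg {
  hopf_alg :> falgType k;
  comul : 'Hom(hopf_alg, hopf_alg \ox hopf_alg);
  counit : 'Hom(hopf_alg, k^o);
  antipode : 'End(hopf_alg);
  comul1 : comul 1 = 1 \ot 1;
  comulM : forall a b, comul (a * b) =
    @tmul k (fdAlg_of_falg hopf_alg) (fdAlg_of_falg hopf_alg)
      (comul a) (comul b);
  counit1 : counit 1 = 1;
  counitM : forall a b, counit (a * b) = counit a * counit b;
  comulA : forall h, tassoc _ _ _ (tmap comul \1 (comul h)) =
                     tmap \1 comul (comul h);
  comul_counitl : forall h,
    tlift (fun h1 h2 => (counit h1 : k) *: h2) (comul h) = h;
  comul_counitr : forall h,
    tlift (fun h1 h2 => (counit h2 : k) *: h1) (comul h) = h;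
  antipodel : forall h,
    tlift (fun h1 h2 => antipode h1 * h2) (comul h) = (counit h : k) *: 1;
  antipoder : forall h,
    tlift (fun h1 h2 => h1 * antipode h2) (comul h) = (counit h : k) *: 1 }.

Record comodAlg (k : fieldType) (H : hopfAlg k) := ComodAlg {
  comod_alg :> fdAlg k;
  coact : 'Hom(comod_alg, comod_alg \ox H);
  coact1 : coact (alg_one _) = alg_one _ \ot 1;
  coactM : forall a b, coact (alg_mul a b) =
    @tmul k comod_alg (fdAlg_of_falg H) (coact a) (coact b);
  coactA : forall a, tassoc _ _ _ (tmap coact \1 (coact a)) =
                     tmap \1 (comul H) (coact a);
  coact_counit : forall a,
    tlift (fun a0 a1 => (counit H a1 : k) *: a0) (coact a) = a }.

Definition regular_comodAlg (k : fieldType) (H : hopfAlg k) : comodAlg H :=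
  @ComodAlg k H (fdAlg_of_falg H) (comul H) (comul1 H) (@comulM k H)
    (@comulA k H) (@comul_counitr k H).

(* The action is an algebra map A -> End_k(M). *)
Record fdMod (k : fieldType) (A : fdAlg k) := FdMod {
  mod_vect :> vectType k;
  act : 'Hom(A, 'End(mod_vect));
  act1 : act (alg_one A) = \1%VF;
  actM : forall a b, act (alg_mul a b) = (act a \o act b)%VF }.

(* H-mod; taking A to be H below makes <| the tensor product of H-mod. *)
Notation rep H := (fdMod (comod_alg (regular_comodAlg H))).

Section Linearity.
Variables (k : fieldType).
Implicit Types (U V W : vectType k) (A : falgType k).

Lemma mulPZl A c (u v x : A) : (c *: u + v) * x = c *: (u * x) + v * x.
Proof. by rewrite mulrDl scalerAl. Qed.
Lemma mulPZr A c (u v x : A) : x * (c *: u + v) = c *: (x * u) + x * v.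
Proof. by rewrite mulrDr scalerAr. Qed.
Lemma scalePZl V c (a b : k^o) (x : V) :
  (c *: a + b : k) *: x = c *: ((a : k) *: x) + (b : k) *: x.
Proof. by rewrite scalerDl scalerA. Qed.
Lemma scalePZr V c d (u v : V) : d *: (c *: u + v) = c *: (d *: u) + d *: v.
Proof. by rewrite scalerDr !scalerA mulrC. Qed.
Definition linPZ := (mulPZl, mulPZr, @lfunPZ k, @tensPl k, @tensPr k, scalePZl,
  scalePZr, add_lfunE, scale_lfunE, comp_lfunE).

Lemma linearE' U V (f : U -> V) (hf : linear f) : linfun f =1 f.
Proof.
by pose fL : {linear U -> V} := HB.pack f (GRing.isLinear.Build k U V *:%R f hf);
   exact: (lfunE fL).
Qed.

Lemma tlift_hom V W U U' (f : 'Hom(U, U')) (b : V -> W -> U) t :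
  f (tlift b t) = tlift (fun v w => f (b v w)) t.
Proof. exact: tlift_comp. Qed.

Lemma linearZ' U V (f : U -> V) (hf : linear f) c u : f (c *: u) = c *: f u.
Proof. by rewrite -!(linearE' hf) linearZ. Qed.

Lemma tlift_lin V W U U' (f : U -> U') (hf : linear f) (b : V -> W -> U) t :
  f (tlift b t) = tlift (fun v w => f (b v w)) t.
Proof.
rewrite -(linearE' hf) tlift_comp.
by apply: eq_tlift => v w; apply: linearE'.
Qed.

End Linearity.

Ltac lin_side := 
  repeat (split || (move=> ?)); rewrite /= ?linPZ //.

Section HopfTheory.
Variables (k : fieldType) (H : hopfAlg k).
Implicit Types (a b h x y z : H) (U : vectType k).
Local Notation S := (antipode H).

Lemma tlift_comulA U (F : H -> H -> H -> U) h : trilin F ->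
  tlift (fun x z => tlift (fun x' y => F x' y z) (comul H x)) (comul H h) =
  tlift (fun x t => tlift (F x) (comul H t)) (comul H h).
Proof. by move=> hF; apply: tlift_assoc hF; rewrite comulA. Qed.

Lemma tlift_counitl U (f : H -> U) (hf : linear f) h :
  tlift (fun x y => (counit H x : k) *: f y) (comul H h) = f h.
Proof.
rewrite -[in RHS](comul_counitl h) (tlift_lin hf).
by apply: eq_tlift => x y; rewrite (linearZ' hf).
Qed.

Lemma tlift_counitr U (f : H -> U) (hf : linear f) h :
  tlift (fun x y => (counit H y : k) *: f x) (comul H h) = f h.
Proof.
rewrite -[in RHS](comul_counitr h) (tlift_lin hf).
by apply: eq_tlift => x y; rewrite (linearZ' hf).
Qed.

Lemma tlift_comulM U (m : H -> H -> U) (hm : bilin m) a b :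
  tlift m (comul H (a * b)) =
  tlift (fun x x' => tlift (fun y y' => m (x * y) (x' * y')) (comul H b))
    (comul H a).
Proof.
rewrite comulM /tmul tlift_comp; apply: eq_tlift => x x'.
by rewrite tlift_comp; apply: eq_tlift => y y'; apply: (tliftE hm).
Qed.

Lemma tlift_antipodel U (f : H -> U) (hf : linear f) h :
  tlift (fun x y => f (S x * y)) (comul H h) = (counit H h : k) *: f 1.
Proof.
by rewrite -(tlift_lin hf) antipodel (linearZ' hf).
Qed.

Lemma tlift_antipoder U (f : H -> U) (hf : linear f) h :
  tlift (fun x y => f (x * S y)) (comul H h) = (counit H h : k) *: f 1.
Proof.
by rewrite -(tlift_lin hf) antipoder (linearZ' hf).
Qed.

Lemma antipode1 : S 1 = 1.
Proof.
have := antipodel (1 : H).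
rewrite comul1 tliftE; first by rewrite mulr1 counit1 scale1r.
lin_side.
Qed.

Lemma antipodeM a b : S (a * b) = S b * S a.
Proof.
symmetry.
transitivity (tlift (fun a1 a2 => tlift (fun b1 b2 =>
    (counit H (a1 * b1) : k) *: (S b2 * S a2)) (comul H b)) (comul H a)).
  have hf : linear (fun y => S b * S y) by lin_side.
  rewrite -(tlift_counitl hf a); apply: eq_tlift => a1 a2.
  have hg : linear (fun y => (counit H a1 : k) *: (S y * S a2)) by lin_side.
  rewrite -(tlift_counitl hg b); apply: eq_tlift => b1 b2.
  by rewrite scalerA counitM mulrC.
transitivity (tlift (fun a1 a2 => tlift (fun x x' => tlift (fun b1 b2 =>
    tlift (fun y y' => S (x * y) * (x' * y') * (S b2 * S a2)) (comul H b1))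
  (comul H b)) (comul H a1)) (comul H a)).
  apply: eq_tlift => a1 a2; rewrite -tlift_exch; apply: eq_tlift => b1 b2.
  have hf : linear (fun y => y * (S b2 * S a2)) by lin_side.
  rewrite -[S b2 * S a2 in LHS]mul1r -(tlift_antipodel hf) tlift_comulM //.
  lin_side.
transitivity (tlift (fun a1 a2 => tlift (fun x x' => S (x * b) * x' * S a2)
   (comul H a1)) (comul H a)).
  apply: eq_tlift => a1 a2; apply: eq_tlift => x x'.
  have hf : linear (fun y => S (x * y) * x' * S a2) by lin_side.
  rewrite -(tlift_counitr hf b) tlift_comulA; last by lin_side.
  apply: eq_tlift => y t.
  have hg : linear (fun z => S (x * y) * x' * z * S a2) by lin_side.
  rewrite -[in RHS](mulr1 (S (x * y) * x')) -(tlift_antipoder hg).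
  by apply: eq_tlift => u v; rewrite !mulrA.
have hf : linear (fun x => S (x * b)) by lin_side.
rewrite -(tlift_counitr hf a) tlift_comulA; last by lin_side.
apply: eq_tlift => x t.
have hg : linear (fun z => S (x * b) * z) by lin_side.
rewrite -[in RHS](mulr1 (S (x * b))) -(tlift_antipoder hg).
by apply: eq_tlift => u v; rewrite !mulrA.
Qed.

End HopfTheory.

Section ModuleCategory.
Variables (k : fieldType) (A : fdAlg k).
Implicit Types (M N P : fdMod A).

Definition Alinear M N : {pred 'Hom(M, N)} :=
  [pred f : 'Hom(M, N) | `[< forall a x, f (act M a x) = act N a (f x) >]].
Arguments Alinear : clear implicits.

Record homA M N := HomA {
  hom_lfun :> 'Hom(M, N);
  hom_lfunP : hom_lfun \in Alinear M N }.

HB.instance Definition _ M N := [isSub for @hom_lfun M N].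
HB.instance Definition _ M N := [Choice of homA M N by <:].

Fact Alinear_submod M N : GRing.submod_closed (Alinear M N).
Proof.
split=> [|c f g /asboolP fA /asboolP gA]; apply/asboolP => a x.
  by rewrite !zero_lfunE linear0.
by rewrite !linPZ fA gA.
Qed.
HB.instance Definition _ M N :=
  GRing.isSubmodClosed.Build k 'Hom(M, N) (Alinear M N) (Alinear_submod M N).
HB.instance Definition _ M N :=
  [SubChoice_isSubLmodule of homA M N by <:].

Lemma homAE M N (f : homA M N) a x : f (act M a x) = act N a (f x).
Proof. by case: f => f /= /asboolP. Qed.

Definition mkHomA M N (f : 'Hom(M, N))
  (fA : forall a x, f (act M a x) = act N a (f x)) : homA M N :=
  HomA (asboolT fA : f \in Alinear M N).

Fact idA_subproof M a x : (\1%VF : 'End(M)) (act M a x) = act M a (\1%VF x).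
Proof. by rewrite !id_lfunE. Qed.
Definition idA M : homA M M := mkHomA (@idA_subproof M).

Fact compA_subproof M N P (g : homA N P) (f : homA M N) a x :
  (g \o f)%VF (act M a x) = act P a ((g \o f)%VF x).
Proof. by rewrite !comp_lfunE !homAE. Qed.
Definition compA M N P (g : homA N P) (f : homA M N) : homA M P :=
  mkHomA (compA_subproof g f).

Definition projective P := forall M N (e : homA M N) (f : homA P N),
  limg e = fullv -> exists l : homA P M, compA e l = f.

Record projMod := ProjMod {
  proj_mod :> fdMod A;
  proj_modP : projective proj_mod }.

End ModuleCategory.
Arguments Alinear {k A} M N.
Notation "g \oA f" := (compA g f) (at level 50, left associativity).

Lemma actPZ (k : fieldType) (A : fdAlg k) (M : fdMod A) c (a b : A) (x : M) :
  act M (c *: a + b) x = c *: act M a x + act M b x.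
Proof. by rewrite !linPZ. Qed.

Section ModuleTensor.
Variables (k : fieldType) (H : hopfAlg k) (A : comodAlg H).
Implicit Types (M N : fdMod A) (X Y Z : rep H) (U : vectType k).

Definition tens_act M X : 'Hom(A \ox H, 'End(M \ox X)) :=
  tlift (fun (a : A) (h : H) => tmap (act M a) (act X h)).

Lemma tens_actE M X (t : A \ox H) m x :
  tens_act M X t (m \ot x) =
  tlift (fun (a : A) (h : H) => act M a m \ot act X h x) t.
Proof.
pose e (f : 'End(M \ox X)) := f (m \ot x).
have he : linear e by move=> c f g; rewrite /e !linPZ.
rewrite -[LHS]/(e _) (tlift_lin he).
by apply: eq_tlift => a h; rewrite /e tmapE.
Qed.

Lemma tlift_coactM (U : vectType k) (m : A -> H -> U) (hm : bilin m) a b :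
  tlift m (coact A (alg_mul a b)) =
  tlift (fun x x' => tlift (fun y y' => m (alg_mul x y) (x' * y')) (coact A b))
    (coact A a).
Proof.
rewrite coactM /tmul tlift_comp; apply: eq_tlift => x x'.
by rewrite tlift_comp; apply: eq_tlift => y y'; apply: (tliftE hm).
Qed.

Lemma tlift_coactA U (F : A -> H -> H -> U) a : trilin F ->
  tlift (fun x z => tlift (fun x' y => F x' y z) (coact A x)) (coact A a) =
  tlift (fun x t => tlift (F x) (comul H t)) (coact A a).
Proof. by move=> hF; apply: tlift_assoc hF; rewrite coactA. Qed.

Lemma tlift_coact_counit U (f : A -> U) (hf : linear f) a :
  tlift (fun x y => (counit H y : k) *: f x) (coact A a) = f a.
Proof.
rewrite -[in RHS](coact_counit a) (tlift_lin hf).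
by apply: eq_tlift => x y; rewrite (linearZ' hf).
Qed.

Lemma ract1 X : act X (1 : H) = \1%VF. Proof. exact: act1. Qed.
Lemma ractM X (g h : H) x : act X (g * h : H) x = act X g (act X h x).
Proof.
exact: etrans (congr1 (fun f : 'End(X) => f x) (actM X g h)) (comp_lfunE _ _ _).
Qed.

Definition tens_modact M X : 'Hom(A, 'End(M \ox X)) :=
  (tens_act M X \o coact A)%VF.

Lemma tens_modactE M X a m x : tens_modact M X a (m \ot x) =
  tlift (fun (b : A) (h : H) => act M b m \ot act X h x) (coact A a).
Proof. by rewrite comp_lfunE tens_actE. Qed.

Fact tens_modact1 M X : tens_modact M X (alg_one A) = \1%VF.
Proof.
apply: lfun_tensP => m x; rewrite tens_modactE coact1 tliftE; last first.
  by lin_side.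
by rewrite act1 ract1 !id_lfunE.
Qed.

Fact tens_modactM M X a b :
  tens_modact M X (alg_mul a b) = (tens_modact M X a \o tens_modact M X b)%VF.
Proof.
apply: lfun_tensP => m x; rewrite [RHS]comp_lfunE !tens_modactE.
rewrite tlift_coactM; last by lin_side.
rewrite tlift_exch tlift_hom; apply: eq_tlift => c g.
rewrite tens_modactE; apply: eq_tlift => c' g'.
by rewrite actM comp_lfunE ractM.
Qed.

(* The action a (m (x) x) = a_(0) m (x) a_(1) x, see tens_modactE. *)
Definition tensMod M X : fdMod A := FdMod (@tens_modact1 M X) (@tens_modactM M X).

End ModuleTensor.

Notation "M <| X" := (tensMod M X).

Section Duality.
Variables (k : fieldType) (H : hopfAlg k).
Implicit Types (X Y : rep H) (g h : H).

Fact unit_act_linear : linear (fun h : H => (counit H h : k) *: (\1%VF : 'End(k^o))).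
Proof. by lin_side. Qed.
Definition unit_act : 'Hom(H, 'End(k^o)) :=
  linfun (fun h : H => (counit H h : k) *: (\1%VF : 'End(k^o))).
Lemma unit_actE h c : unit_act h c = counit H h * c.
Proof. by rewrite /unit_act (linearE' unit_act_linear) scale_lfunE id_lfunE. Qed.
Fact unit_act1 : unit_act 1 = \1%VF.
Proof. by apply/lfunP => c; rewrite unit_actE counit1 mul1r id_lfunE. Qed.
Fact unit_actM g h : unit_act (g * h) = (unit_act g \o unit_act h)%VF.
Proof.
by apply/lfunP => c; rewrite comp_lfunE !unit_actE counitM mulrA.
Qed.
Definition unitMod : rep H :=
  @FdMod k (regular_comodAlg H) k^o unit_act unit_act1 unit_actM.

Definition dual_act X : 'Hom(H, 'End('Hom(X, k^o))) :=
  linfun (fun h : H => linfun (fun f : 'Hom(X, k^o) =>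
    (f \o act X (antipode H h))%VF)).
Lemma dual_actE X h f x : dual_act X h f x = f (act X (antipode H h) x).
Proof.
have h1 g : linear (fun f : 'Hom(X, k^o) => (f \o act X (antipode H g))%VF).
  by move=> c u v; apply/lfunP => y; rewrite !linPZ.
rewrite /dual_act linearE'; first by rewrite (linearE' (h1 h)) comp_lfunE.
move=> c u v; apply/lfunP => f'; apply/lfunP => y.
by rewrite (linearE' (h1 _)) !linPZ !(linearE' (h1 _)) !linPZ.
Qed.
Fact dual_act1 X : dual_act X 1 = \1%VF.
Proof.
apply/lfunP => f; apply/lfunP => x.
by rewrite dual_actE antipode1 ract1 !id_lfunE.
Qed.
Fact dual_actM X g h : dual_act X (g * h) = (dual_act X g \o dual_act X h)%VF.
Proof.
apply/lfunP => f; apply/lfunP => x.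
by rewrite comp_lfunE !dual_actE antipodeM ractM.
Qed.
(* <h f, x> = <f, S(h) x>, see dual_actE. *)
Definition dual X : rep H :=
  @FdMod k (regular_comodAlg H) 'Hom(X, k^o) (dual_act X) (dual_act1 X)
    (@dual_actM X).

Definition ev_fun X : 'Hom(dual X \ox X, k^o) :=
  tlift (fun (f : 'Hom(X, k^o)) (x : X) => f x).
Lemma ev_funE X (f : 'Hom(X, k^o)) (x : X) : ev_fun X (tens (f : dual X) x) = f x.
Proof. by apply: tliftE; lin_side. Qed.
Fact ev_subproof X h t :
  ev_fun X (act (dual X <| X) h t) = act unitMod h (ev_fun X t).
Proof.
elim/tensor_ind: t => [f x|c s t es et]; last by rewrite !lfunPZ es et.
rewrite ev_funE [RHS]unit_actE [act _ _ _]tens_modactE tlift_hom.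
have hf : linear (fun z : H => f (act X z x)) by lin_side.
transitivity (tlift (fun y z => f (act X (antipode H y * z : H) x)) (comul H h)).
  apply: eq_tlift => y z.
  by rewrite ev_funE ractM -dual_actE.
by rewrite (tlift_antipodel hf) ract1 id_lfunE.
Qed.
Definition ev X : homA (dual X <| X) unitMod :=
  @mkHomA k (regular_comodAlg H) (dual X <| X) unitMod (ev_fun X)
    (@ev_subproof X).

End Duality.

Section Coevaluation.
Variables (k : fieldType) (H : hopfAlg k).
Implicit Types (X Y : rep H) (g h : H).

Definition dual_basis X (i : 'I_(\dim {:X})) : dual X :=
  linfun (coord (vbasis {:X}) i : X -> k^o).
Lemma dual_basisE X i (x : X) :
  (dual_basis i : 'Hom(X, k^o)) x = coord (vbasis {:X}) i x.
Proof. exact: lfunE. Qed.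

(* The image of 1 under coev, written on the library basis of X. *)
Definition coev_elt X : X \ox dual X :=
  \sum_(i < \dim {:X}) ((vbasis {:X})`_i \ot dual_basis i).
Definition coev_fun X : 'Hom(k^o, X \ox dual X) :=
  linfun (fun c : k^o => (c : k) *: coev_elt X).
Lemma coev_funE X c : coev_fun X c = (c : k) *: coev_elt X.
Proof. by rewrite /coev_fun linearE' // => a u v; rewrite scalePZl. Qed.

Lemma coev_slide X (f : 'End(X)) (g : dual X -> dual X) :
  (forall (p : dual X) (x : X),
     (g p : 'Hom(X, k^o)) x = (p : 'Hom(X, k^o)) (f x)) ->
  \sum_(i < \dim {:X}) ((vbasis {:X})`_i \ot g (dual_basis i)) =
  \sum_(i < \dim {:X}) (f (vbasis {:X})`_i \ot dual_basis i).
Proof.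
move=> gf; set e := vbasis _.
have gE i : g (dual_basis i) =
    \sum_(j < \dim {:X}) coord e i (f e`_j) *: dual_basis j.
  apply/lfunP => x; rewrite gf dual_basisE sum_lfunE.
  rewrite {1}(coord_vbasis (memvf x)) linear_sum /= linear_sum /=.
  apply: eq_bigr => j _.
  by rewrite !linearZ /= scale_lfunE dual_basisE [RHS]mulrC.
under eq_bigr => i _ do rewrite gE (bilin_sumr (@tens_bilin _ _ _)).
rewrite exchange_big /=; apply: eq_bigr => j _.
rewrite [in RHS](coord_vbasis (memvf (f e`_j))).
by rewrite (bilin_suml (@tens_bilin _ _ _)).
Qed.

Lemma tens_actmap X Y h (t : X \ox Y) :
  act (X <| Y) h t =
  tlift (fun x y : H => tmap (act X x) (act Y y) t) (comul H h).
Proof.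
elim/tensor_ind: t => [v w|c s t es et].
  rewrite [LHS]tens_modactE; apply: eq_tlift => x y.
  by rewrite tmapE.
rewrite lfunPZ es et -tliftP; apply: eq_tlift => x y.
by rewrite lfunPZ.
Qed.

Lemma coev_antipode X h :
  act (X <| dual X) h (coev_elt X) = (counit H h : k) *: coev_elt X.
Proof.
pose f (z : H) : X \ox dual X :=
  \sum_(i < \dim {:X}) (act X z (vbasis {:X})`_i \ot dual_basis i).
have hf : linear f.
  move=> c u v; rewrite /f scaler_sumr -big_split; apply: eq_bigr => i _.
  by rewrite !linPZ.
have f1 : f 1 = coev_elt X.
  by apply: eq_bigr => i _; rewrite ract1 id_lfunE.
rewrite -f1 -(tlift_antipoder hf) f1 tens_actmap; apply: eq_tlift => x y.
transitivity (tmap (act X x) \1%VF (\sum_(i < \dim {:X})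
   ((vbasis {:X})`_i \ot act (dual X) y (dual_basis i)))).
  rewrite /coev_elt !linear_sum; apply: eq_bigr => i _ /=.
  by rewrite !tmapE id_lfunE.
rewrite (@coev_slide X (act X (antipode H y))); last first.
  by move=> p v; rewrite -[RHS]dual_actE.
rewrite linear_sum; apply: eq_bigr => i _ /=.
by rewrite tmapE id_lfunE ractM.
Qed.

Fact coev_subproof X h c :
  coev_fun X (act (unitMod H) h c) = act (X <| dual X) h (coev_fun X c).
Proof.
rewrite [act (unitMod H) h c]unit_actE !coev_funE.
rewrite (linearZ' (@lfunPZ _ _ _ (act (X <| dual X) h))) coev_antipode.
by rewrite scalerA mulrC.
Qed.
Definition coev X : homA (unitMod H) (X <| dual X) :=
  @mkHomA k (regular_comodAlg H) (unitMod H) (X <| dual X) (coev_fun X)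
    (@coev_subproof X).

End Coevaluation.

Section ModuleCategoryStructure.
Variables (k : fieldType) (H : hopfAlg k) (A : comodAlg H).
Implicit Types (M N : fdMod A) (X Y : rep H).

Fact tensA_subproof M N X Y (f : homA M N) (g : homA X Y) a t :
  tmap f g (act (M <| X) a t) = act (N <| Y) a (tmap f g t).
Proof.
elim/tensor_ind: t => [m x|c s t es et]; last by rewrite !lfunPZ es et.
rewrite tmapE [act (M <| X) a _]tens_modactE [RHS]tens_modactE tlift_hom.
by apply: eq_tlift => b h; rewrite tmapE !homAE.
Qed.
Definition tensA M N X Y (f : homA M N) (g : homA X Y) :
    homA (M <| X) (N <| Y) :=
  @mkHomA k A (M <| X) (N <| Y) (tmap f g) (tensA_subproof f g).

Fact assocA_subproof M X Y a t :
  tassoc M X Y (act ((M <| X) <| Y) a t) = act (M <| (X <| Y)) a (tassoc M X Y t).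
Proof.
elim/tensor_ind: t => [t y|c s t es et]; last by rewrite !lfunPZ es et.
elim/tensor_ind: t => [m x|c s t es et]; last first.
  by rewrite !tensPl !lfunPZ es et.
rewrite tassocE [act _ a _]tens_modactE [RHS]tens_modactE tlift_hom.
transitivity (tlift (fun b h => tlift (fun c g =>
   act M c m \ot (act X g x \ot act Y h y)) (coact A b)) (coact A a)).
  apply: eq_tlift => b h; rewrite [act _ b _]tens_modactE.
  have hf : linear (fun u : M \ox X => tassoc M X Y (u \ot act Y h y)).
    by move=> c u v; rewrite !linPZ.
  rewrite (tlift_lin hf); apply: eq_tlift => c g; exact: tassocE.
rewrite tlift_coactA; last by lin_side.
apply: eq_tlift => b h; rewrite [act (X <| Y) h _]tens_modactE.
have hf : linear (fun u : X \ox Y => act M b m \ot u).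
  by move=> c u v; rewrite !linPZ.
by rewrite (tlift_lin hf).
Qed.
Definition assocA M X Y : homA ((M <| X) <| Y) (M <| (X <| Y)) :=
  @mkHomA k A ((M <| X) <| Y) (M <| (X <| Y)) (tassoc M X Y)
    (@assocA_subproof M X Y).

Fact assocVA_subproof M X Y a t :
  tassocV M X Y (act (M <| (X <| Y)) a t) =
  act ((M <| X) <| Y) a (tassocV M X Y t).
Proof.
have K1 : cancel (tassocV M X Y) (tassoc M X Y).
  elim/tensor_ind=> [m u|c u v eu ev]; last by rewrite !lfunPZ eu ev.
  elim/tensor_ind: u => [x y|c u v eu ev]; last by rewrite !tensPr !lfunPZ eu ev.
  by rewrite tassocVE tassocE.
have K2 : cancel (tassoc M X Y) (tassocV M X Y).
  elim/tensor_ind=> [u y|c u v eu ev]; last by rewrite !lfunPZ eu ev.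
  elim/tensor_ind: u => [m x|c u v eu ev]; last by rewrite !tensPl !lfunPZ eu ev.
  by rewrite tassocE tassocVE.
apply: (can_inj K2); rewrite K1 assocA_subproof K1 //.
Qed.
Definition assocVA M X Y : homA (M <| (X <| Y)) ((M <| X) <| Y) :=
  @mkHomA k A (M <| (X <| Y)) ((M <| X) <| Y) (tassocV M X Y)
    (@assocVA_subproof M X Y).

(* The canonical isomorphism M (x) k = M and its inverse. *)
Definition runit_fun M : 'Hom(M \ox unitMod H, M) :=
  tlift (fun (m : M) (c : k^o) => (c : k) *: m).
Lemma runit_funE M (m : M) (c : unitMod H) :
  runit_fun M (m \ot c) = ((c : k^o) : k) *: m.
Proof.
by apply: tliftE; split=> [c' d u v|m' d u v]; rewrite ?scalePZr ?scalePZl.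
Qed.
Definition runitV_fun M : 'Hom(M, M \ox unitMod H) :=
  linfun (fun m : M => m \ot (1 : k^o)).
Lemma runitV_funE M m : runitV_fun M m = m \ot (1 : k^o).
Proof. by rewrite /runitV_fun linearE' // => c u v; rewrite tensPl. Qed.

Fact runitA_subproof M a t :
  runit_fun M (act (M <| unitMod H) a t) = act M a (runit_fun M t).
Proof.
elim/tensor_ind: t => [m c|c s t es et]; last by rewrite !lfunPZ es et.
rewrite runit_funE [act _ a _]tens_modactE tlift_hom.
have hf : linear (fun b => act M b ((c : k) *: m)) by lin_side.
rewrite -(tlift_coact_counit hf); apply: eq_tlift => b h.
by rewrite runit_funE [act (unitMod H) h c]unit_actE linearZ scalerA.
Qed.
Definition runitA M : homA (M <| unitMod H) M :=
  @mkHomA k A (M <| unitMod H) M (runit_fun M) (@runitA_subproof M).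

Fact runitVA_subproof M a m :
  runitV_fun M (act M a m) = act (M <| unitMod H) a (runitV_fun M m).
Proof.
have tZ (c : k^o) (x : M) :
    x \ot (c : unitMod H) = ((c : k) *: x) \ot (1 : k^o) :> (M \ox unitMod H).
  rewrite (linearZ' (fun d u v => @tensPl _ _ _ d u v (1 : k^o))).
  rewrite -(linearZ' (fun d u v => @tensPr _ M (k^o) d x u v)).
  by congr (_ \ot _); rewrite /= [RHS]mulr1.
rewrite !runitV_funE [RHS]tens_modactE.
have hf : linear (fun b => act M b m \ot (1 : k^o)) by lin_side.
rewrite -(tlift_coact_counit hf); apply: eq_tlift => b h.
rewrite tZ (linearZ' (fun d u v => @tensPl _ _ _ d u v (1 : k^o))).
by rewrite unit_actE mulr1.
Qed.
Definition runitVA M : homA M (M <| unitMod H) :=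
  @mkHomA k A M (M <| unitMod H) (runitV_fun M) (@runitVA_subproof M).

End ModuleCategoryStructure.

Section TensorProjective.
Variables (k : fieldType) (H : hopfAlg k) (A : comodAlg H).
Implicit Types (M N P : fdMod A) (X Y : rep H).

Lemma homA_inj M N (f g : homA M N) : f =1 g -> f = g.
Proof. by move=> fg; apply: val_inj; apply/lfunP. Qed.

Lemma compAE M N P (g : homA N P) (f : homA M N) x : (g \oA f) x = g (f x).
Proof. exact: comp_lfunE. Qed.

Lemma tensA_surj M N X (e : homA M N) :
  limg e = fullv -> limg (tensA e (idA X)) = fullv.
Proof.
move=> se; apply/eqP; rewrite eqEsubv subvf /=; apply/subvP => v _.
have -> : v = tensA e (idA X) (tmap (e^-1)%VF \1%VF v).
  rewrite -[RHS]comp_lfunE -tmap_comp comp_lfun1l.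
  have -> : (e \o e^-1)%VF = \1%VF.
    by apply/lfunP => n; rewrite comp_lfunE limg_lfunVK ?se ?memvf // id_lfunE.
  by rewrite tmap1 id_lfunE.
by rewrite memv_img ?memvf.
Qed.

Definition adj M N X (f : homA (M <| X) N) : homA M (N <| dual X) :=
  tensA f (idA (dual X)) \oA assocVA M X (dual X) \oA
    tensA (idA M) (coev X) \oA runitVA M.
Definition eva M X : homA ((M <| dual X) <| X) M :=
  runitA M \oA tensA (idA M) (ev X) \oA assocA M (dual X) X.

Lemma adjE M N X (f : homA (M <| X) N) m :
  adj f m = \sum_(i < \dim {:X}) (f (m \ot (vbasis {:X})`_i) \ot dual_basis i).
Proof.
rewrite !compAE runitV_funE tmapE id_lfunE coev_funE scale1r.
have h : linear (fun t : X \ox dual X => m \ot t) by lin_side.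
rewrite /coev_elt -(linearE' h) !linear_sum; apply: eq_bigr => i _ /=.
by rewrite (linearE' h) tassocVE tmapE id_lfunE.
Qed.

Lemma evaE M X m (p : dual X) x :
  eva M X (m \ot p \ot x) = ((p : 'Hom(X, k^o)) x : k) *: m.
Proof. by rewrite !compAE tassocE tmapE id_lfunE ev_funE runit_funE. Qed.

Lemma projective_tensMod P X : projective P -> projective (P <| X).
Proof.
move=> pP M N e f se.
have [l el] := pP _ _ _ (adj f) (tensA_surj (dual X) se).
exists (eva M X \oA tensA l (idA X)).
apply: val_inj; apply: lfun_tensP => p x.
rewrite [LHS]comp_lfunE [X in e X]comp_lfunE tmapE id_lfunE.
have eeva t : e (eva M X (t \ot x)) = eva N X (tensA e (idA (dual X)) t \ot x).
  elim/tensor_ind: t => [m q|c s t es et]; last first.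
    by rewrite tensPl !lfunPZ tensPl lfunPZ es et.
  by rewrite tmapE id_lfunE !evaE linearZ.
rewrite eeva -[tensA _ _ _]compAE el adjE.
have h : linear (fun t : N \ox dual X => eva N X (t \ot x)) by lin_side.
rewrite -(linearE' h) linear_sum /=.
rewrite [in RHS](coord_vbasis (memvf x)).
have h' : linear (fun y => f (p \ot y)) by lin_side.
rewrite -(linearE' h') linear_sum; apply: eq_bigr => i _ /=.
by rewrite (linearE' h) evaE dual_basisE linearZ /= (linearE' h').
Qed.

Definition tensProj (P : projMod A) X : projMod A :=
  ProjMod (@projective_tensMod P X (@proj_modP _ _ P)).

End TensorProjective.

Record pivotal (k : fieldType) (H : hopfAlg k) := Pivotal {
  piv_elt : H;
  piv_comul : comul H piv_elt = piv_elt \ot piv_elt;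
  piv_counit : counit H piv_elt = 1;
  piv_antipode : forall h,
    antipode H (antipode H h) = piv_elt * h * piv_elt^-1 }.

Section Pivotal.
Variables (k : fieldType) (H : hopfAlg k) (g : pivotal H).
Implicit Types (X : rep H).
Local Notation gp := (piv_elt g).

Lemma piv_unit : gp \is a GRing.unit.
Proof.
apply/unitrP; exists (antipode H gp); split.
  have := antipodel gp; rewrite piv_comul piv_counit scale1r tliftE //.
  by lin_side.
have := antipoder gp; rewrite piv_comul piv_counit scale1r tliftE //.
by lin_side.
Qed.

Definition piv_fun X : 'Hom(X, dual (dual X)) :=
  linfun (fun x : X => linfun (fun f : 'Hom(X, k^o) => f (act X gp x))).
Lemma piv_funE X (x : X) (f : dual X) :
  (piv_fun X x : 'Hom(dual X, k^o)) f = (f : 'Hom(X, k^o)) (act X gp x).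
Proof.
have h y : linear (fun f : 'Hom(X, k^o) => f (act X gp y)) by lin_side.
rewrite /piv_fun linearE'; first by rewrite (linearE' (h x)).
by move=> c u v; apply/lfunP => f';
   rewrite add_lfunE scale_lfunE !(linearE' (h _)) !lfunPZ.
Qed.

Fact piv_subproof X h x :
  piv_fun X (act X h x) = act (dual (dual X)) h (piv_fun X x).
Proof.
apply/lfunP => f.
rewrite [LHS]piv_funE [RHS]dual_actE [RHS]piv_funE [RHS]dual_actE.
by rewrite (piv_antipode g) -!ractM mulrVK ?piv_unit.
Qed.
Definition piv X : homA X (dual (dual X)) :=
  @mkHomA k (regular_comodAlg H) X (dual (dual X)) (piv_fun X)
    (@piv_subproof X).

Lemma piv_inj X : cancel (piv_fun X) (piv_fun X)^-1%VF.
Proof.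
apply: lker0_lfunK; apply/eqP/vspaceP => x; rewrite memv_ker memv0.
apply/eqP/eqP => [x0|->]; last by rewrite linear0.
have gx0 : act X gp x = 0.
  rewrite (coord_vbasis (memvf (act X gp x))) big1 // => i _.
  rewrite -dual_basisE -(piv_funE x) x0 zero_lfunE scale0r //.
by rewrite -[x](id_lfunE x) -ract1 -(mulVr piv_unit) ractM gx0 linear0.
Qed.

Lemma piv_surj X : cancel (piv_fun X)^-1%VF (piv_fun X).
Proof.
move=> F; apply: limg_lfunVK.
pose x := \sum_(i < \dim {:X})
  ((F : 'Hom(dual X, k^o)) (dual_basis i) : k) *: (vbasis {:X})`_i.
have -> : F = piv_fun X (act X (gp^-1) x).
  apply/lfunP => f; rewrite piv_funE -ractM divrr ?piv_unit // ract1 id_lfunE.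
  rewrite /x linear_sum /=.
  have -> : f = \sum_(i < \dim {:X})
      (((f : 'Hom(X, k^o)) (vbasis {:X})`_i : k) *: dual_basis i).
    apply/lfunP => y; rewrite sum_lfunE [in LHS](coord_vbasis (memvf y)).
    rewrite linear_sum; apply: eq_bigr => i _ /=.
    by rewrite linearZ scale_lfunE dual_basisE [RHS]mulrC.
  rewrite linear_sum; apply: eq_bigr => i _ /=.
  rewrite !linearZ /= sum_lfunE (bigD1 i) //= big1 => [|j ji].
    by rewrite addr0 scale_lfunE dual_basisE coord_vbasisE eqxx [RHS]mulrC [_ *: 1]mulr1.
  by rewrite scale_lfunE dual_basisE coord_vbasisE (negPf ji) scaler0.
by rewrite memv_img ?memvf.
Qed.

Fact pivV_subproof X h F :
  (piv_fun X)^-1%VF (act (dual (dual X)) h F) =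
  act X h ((piv_fun X)^-1%VF F).
Proof. by apply: (can_inj (@piv_inj X)); rewrite piv_subproof !piv_surj. Qed.
Definition pivV X : homA (dual (dual X)) X :=
  @mkHomA k (regular_comodAlg H) (dual (dual X)) X (piv_fun X)^-1%VF
    (@pivV_subproof X).

End Pivotal.

Section ModifiedTraces.
Variables (k : fieldType) (H : hopfAlg k) (g : pivotal H) (A : comodAlg H).

(* (id_P (x) ev_{X^*}) (f (x) id_{X^*}) (id_P (x) coev_X), with the
   identifications P = P (x) k and the associativity isomorphisms inserted. *)
Definition ptrace (P : fdMod A) (X : rep H)
    (f : homA (P <| X) (P <| dual (dual X))) : homA P P :=
  runitA P \oA tensA (idA P) (ev (dual X)) \oA
    assocA P (dual (dual X)) (dual X) \oA tensA f (idA (dual X)) \oA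
    assocVA P X (dual X) \oA tensA (idA P) (coev X) \oA runitVA P.

Definition is_mtrace (t : forall P : projMod A, homA P P -> k) : Prop :=
  [/\ forall (P : projMod A) c (f f' : homA P P),
        t P (c *: f + f') = c * t P f + t P f',
      forall (P Q : projMod A) (f : homA P Q) (f' : homA Q P),
        t P (f' \oA f) = t Q (f \oA f')
    & forall (P : projMod A) (X : rep H)
        (f : homA (P <| X) (P <| dual (dual X))),
        t P (ptrace f) = t (tensProj P X) (tensA (idA P) (pivV g X) \oA f)].

Record mtrace := MTrace {
  mtrace_fam :> forall P : projMod A, homA P P -> k;
  mtraceP : is_mtrace mtrace_fam }.

Fact mtrace_lin_subproof (c : k) (s t : mtrace) :
  is_mtrace (fun P f => c * s P f + t P f).
Proof.
have [s1 s2 s3] := mtraceP s; have [t1 t2 t3] := mtraceP t.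
split=> [P d f f'|P Q f f'|P X f].
- by rewrite s1 t1 !mulrDr !mulrA [c * d]mulrC addrACA.
- by rewrite s2 t2.
- by rewrite s3 t3.
Qed.
(* The linear combination c s + t. The type mtrace is too large, universe-wise,
   to be given an lmodType structure. *)
Definition mtrace_lin (c : k) (s t : mtrace) : mtrace :=
  MTrace (mtrace_lin_subproof c s t).

Definition is_twisted_form (l : 'Hom(A, k^o)) : Prop :=
  (forall a b, l (alg_mul a b) = l (alg_mul b a)) /\
  (forall a, tlift (fun (a0 : A) (a1 : H) => (l a0 : k) *: a1) (coact A a) =
             (l a : k) *: (piv_elt g)^-1).

Definition twisted_form_pred : {pred 'Hom(A, k^o)} :=
  [pred l | `[< is_twisted_form l >]].

Record twisted_form := TwistedForm {
  twisted_form_lfun :> 'Hom(A, k^o);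
  twisted_formP : twisted_form_lfun \in twisted_form_pred }.
HB.instance Definition _ := [isSub for twisted_form_lfun].
HB.instance Definition _ := [Choice of twisted_form by <:].

Fact twisted_form_submod : GRing.submod_closed twisted_form_pred.
Proof.
split=> [|c l m /asboolP[l1 l2] /asboolP[m1 m2]]; apply/asboolP.
  split=> [a b|a]; rewrite !zero_lfunE // scale0r.
  rewrite -[RHS](linear0 (tlift (fun (_ : A) (_ : H) => 0 : H))).
  have e : (fun (a0 : A) (a1 : H) => ((0 : 'Hom(A, k^o)) a0 : k) *: a1) =
           (fun _ _ => 0) by apply/funext => x; apply/funext => y; rewrite zero_lfunE scale0r.
  rewrite e linear0 lfunE /= /tlift_fun big1 // => i _.
  by rewrite big1 // => j _; rewrite scaler0.
split=> [a b|a]; first by rewrite !linPZ l1 m1.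
rewrite add_lfunE scale_lfunE scalePZl -l2 -m2 -tliftP; apply: eq_tlift => x y.
by rewrite add_lfunE scale_lfunE scalePZl.
Qed.
HB.instance Definition _ :=
  GRing.isSubmodClosed.Build k 'Hom(A, k^o) twisted_form_pred
    twisted_form_submod.
HB.instance Definition _ := [SubChoice_isSubLmodule of twisted_form by <:].

End ModifiedTraces.

(* Main.v *)
From HB Require Import structures.
Require Import Defs.
From mathcomp Require Import all_boot ssralg vector falgebra.
From mathcomp Require Import matrix boolp.
Set Implicit Arguments.
Unset Strict Implicit.
Unset Printing Implicit Defensive.
Import GRing.Theory.
Local Open Scope ring_scope.

(** A trace t is determined by the form a |-> t_A(x |-> x a): if (p_i, phi_i) is
    a dual basis of the projective module P, then f is the sum of the maps
    f p_i phi_i, so that t_P(f) is the sum of the values of the form on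
    phi_i(f(p_i)). Conversely, for a symmetric form this sum does not depend on
    the dual basis and is cyclic.

    To compare with partial traces, use that A <| X is free: the functionals
    psi_e(a (x) x) = <e, S(a_(1)) x> a_(0), for e in a basis of X^*, are dual to
    the vectors 1 (x) x_i. Hence the partial trace property amounts to
    l(a_(0)) S(a_(1)) = l(a) g, by taking X = H for the direct implication. As
    S^2 is inner, S is injective, and S(g^-1) = g gives the twisted condition. *)

(** * Free modules, dual bases of projective modules, and traces of symmetric forms *)

Section FreeModules.
Variables (k : fieldType) (A : fdAlg k).
Implicit Types (M N P Q : fdMod A) (V : vectType k).

Lemma alg_mulPl c (a b x : A) :
  alg_mul (c *: a + b) x = c *: alg_mul a x + alg_mul b x.
Proof. exact: (alg_bilin A).1. Qed.

Lemma alg_mulPr c (x a b : A) :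
  alg_mul x (c *: a + b) = c *: alg_mul x a + alg_mul x b.
Proof. exact: (alg_bilin A).2. Qed.

Fact lmul_linear : linear (fun a : A => linfun (alg_mul a) : 'End(A)).
Proof.
move=> c a b; apply/lfunP => x; rewrite !linPZ !linearE' ?alg_mulPl //;
by move=> d u v; rewrite alg_mulPr.
Qed.

Definition lmul : 'Hom(A, 'End(A)) := linfun (fun a : A => linfun (alg_mul a)).

Lemma lmulE a b : lmul a b = alg_mul a b.
Proof.
rewrite /lmul (linearE' lmul_linear) linearE' // => c u v.
by rewrite alg_mulPr.
Qed.

Fact lmul1 : lmul (alg_one A) = \1%VF.
Proof. by apply/lfunP => b; rewrite lmulE alg_mul1 id_lfunE. Qed.

Fact lmulM a b : lmul (alg_mul a b) = (lmul a \o lmul b)%VF.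
Proof. by apply/lfunP => c; rewrite comp_lfunE !lmulE alg_mulA. Qed.

Definition regMod : fdMod A := FdMod lmul1 lmulM.

Fact free_act_linear V :
  linear (fun a : A => tmap (lmul a) \1 : 'End(A \ox V)).
Proof. by move=> c a b; rewrite lfunPZ (tmap_bilin _ _ _ _).1. Qed.

Definition free_act V : 'Hom(A, 'End(A \ox V)) :=
  linfun (fun a : A => tmap (lmul a) \1).

Lemma free_actE V a (b : A) (v : V) :
  free_act V a (b \ot v) = alg_mul a b \ot v.
Proof. by rewrite /free_act (linearE' (@free_act_linear V)) tmapE lmulE id_lfunE. Qed.

Fact free_act1 V : free_act V (alg_one A) = \1%VF.
Proof. by apply: lfun_tensP => b v; rewrite free_actE alg_mul1 id_lfunE. Qed.

Fact free_actM V a b :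
  free_act V (alg_mul a b) = (free_act V a \o free_act V b)%VF.
Proof. by apply: lfun_tensP => c v; rewrite comp_lfunE !free_actE alg_mulA. Qed.

(** [V] is a bare vector space and only the left factor is acted on, so no coaction enters. For [V]
    the space underlying a module [P], this free module maps onto [P] by [free_eval]. *)
Definition freeMod V : fdMod A := FdMod (@free_act1 V) (@free_actM V).

Lemma act1E M (m : M) : act M (alg_one A) m = m.
Proof. by rewrite act1 id_lfunE. Qed.

Fact gen_linear M (m : M) : linear (fun a : A => act M a m).
Proof. by move=> c a b; rewrite actPZ. Qed.

Lemma gen_funE M (m : M) a : linfun (fun a : A => act M a m) a = act M a m.
Proof. by rewrite (linearE' (@gen_linear M m)). Qed.

Fact gen_subproof M (m : M) a (x : regMod) :
  linfun (fun a : A => act M a m) (act regMod a x) =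
  act M a (linfun (fun a : A => act M a m) x).
Proof. by rewrite [act regMod a x]lmulE !gen_funE actM comp_lfunE. Qed.

Definition gen M (m : M) : homA regMod M := mkHomA (@gen_subproof M m).

Lemma genE M (m : M) (a : regMod) : gen m a = act M a m.
Proof. exact: gen_funE. Qed.

Lemma homA_eq M N (f g : homA M N) : f =1 g -> f = g.
Proof. by move=> fg; apply: val_inj; apply/lfunP. Qed.

Lemma compE M N P (g : homA N P) (f : homA M N) x : (g \oA f) x = g (f x).
Proof. exact: comp_lfunE. Qed.

Lemma addAE M N (f g : homA M N) x : (f + g) x = f x + g x.
Proof. exact: add_lfunE. Qed.

Lemma scaleAE M N c (f : homA M N) x : (c *: f) x = c *: f x.
Proof. exact: scale_lfunE. Qed.

Lemma sumAE M N (I : Type) (r : seq I) (f : I -> homA M N) x :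
  (\sum_(i <- r) f i) x = \sum_(i <- r) f i x.
Proof.
elim: r => [|i r IH]; first by rewrite !big_nil; apply: zero_lfunE.
by rewrite !big_cons addAE IH.
Qed.

Lemma comp_gen M N (f : homA M N) (m : M) : f \oA gen m = gen (f m).
Proof. by apply: homA_eq => a; rewrite compE !genE homAE. Qed.

Lemma homA_gen M (f : homA regMod M) : f = gen (f (alg_one A)).
Proof.
apply: homA_eq => a; rewrite genE -homAE; congr (fun_of_lfun f _).
by rewrite [RHS]lmulE alg_mulr1.
Qed.

Lemma homA_regE M (f : homA M regMod) a x :
  f (act M a x) = alg_mul a (f x).
Proof. by have := homAE f a x; rewrite lmulE. Qed.

(** A map out of [A] is fixed by its value at the unit, so it lifts as soon as that one vector has a
    preimage. *)
Lemma projective_regMod : projective regMod.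
Proof.
move=> M N e f se; exists (gen ((e^-1)%VF (f (alg_one A)))).
apply: homA_eq => a; rewrite compE genE homAE limg_lfunVK ?se ?memvf //.
by rewrite -homAE [act _ _ _]lmulE alg_mulr1.
Qed.

Definition regProj : projMod A := ProjMod projective_regMod.

(** The notion of the dual basis lemma for projective modules: generators with [A]-linear, possibly
    non-unique, coordinates. *)
Definition is_dual_basis P (I : finType) (p : I -> P)
    (phi : I -> homA P regMod) : Prop :=
  forall x, \sum_i act P (phi i x) (p i) = x.

Lemma dual_basis_regMod :
  is_dual_basis (fun _ : unit => alg_one A : regMod) (fun=> idA regMod).
Proof.
by move=> a; rewrite (big_pred1 tt) => [|[] //]; rewrite id_lfunE [LHS]lmulE alg_mulr1.
Qed.

Fact free_eval_subproof P a (t : freeMod P) :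
  tlift (fun (a : A) (x : P) => act P a x) (act (freeMod P) a t) =
  act P a (tlift (fun (a : A) (x : P) => act P a x) t).
Proof.
have hb : bilin (fun (a : A) (x : P) => act P a x) by lin_side.
elim/tensor_ind: t => [b x|c s t es et]; last by rewrite !lfunPZ es et.
by rewrite [act _ a _]free_actE !tliftE // actM comp_lfunE.
Qed.

Definition free_eval P : homA (freeMod P) P := mkHomA (@free_eval_subproof P).

Fact free_coord_bilin V (p : 'Hom(V, k^o)) :
  bilin (fun (a : A) (v : V) => (p v : k) *: a).
Proof. by split=> [v c a b|a c u v]; rewrite ?scalePZr // !linPZ. Qed.

Fact free_coord_subproof V (p : 'Hom(V, k^o)) a (t : freeMod V) :
  tlift (fun (a : A) (v : V) => (p v : k) *: a) (act (freeMod V) a t) =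
  act regMod a (tlift (fun (a : A) (v : V) => (p v : k) *: a) t).
Proof.
elim/tensor_ind: t => [b x|c s t es et]; last by rewrite !lfunPZ es et.
rewrite [act _ a _]free_actE !tliftE; try exact: free_coord_bilin.
by rewrite linearZ /= lmulE.
Qed.

Definition free_coord V (p : 'Hom(V, k^o)) : homA (freeMod V) regMod :=
  @mkHomA k A (freeMod V) regMod _ (@free_coord_subproof V p).

(** Projectivity splits the surjection [free_eval] by some [l]; the functionals are the coordinates
    of the free module along a vector space basis of [P], precomposed with [l]. *)
Lemma projective_dual_basis P : projective P ->
  exists phi : 'I_(\dim {:P}) -> homA P regMod,
    is_dual_basis (fun i : 'I_(_) => (vbasis {:P})`_i) phi.
Proof.
have eE (a : A) (x : P) : free_eval P (a \ot x) = act P a x.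
  by apply: tliftE; lin_side.
move=> pP; have se : limg (free_eval P) = fullv.
  apply/eqP; rewrite eqEsubv subvf; apply/subvP => x _.
  have -> : x = free_eval P (alg_one A \ot x) by rewrite eE act1 id_lfunE.
  by rewrite memv_img ?memvf.
have [l el] := pP _ _ _ (idA P) se.
pose e i : 'Hom(P, k^o) := linfun (coord (vbasis {:P}) i : P -> k^o).
exists (fun i => free_coord (e i) \oA l) => x.
have {2}<- : free_eval P (l x) = x by rewrite -compE el id_lfunE.
under eq_bigr => i _ do rewrite compE.
elim/tensor_ind: (l x) => [a y|c s t es et].
  rewrite eE [in RHS](coord_vbasis (memvf y)) linear_sum; apply: eq_bigr => i _.
  rewrite [free_coord _ _]tliftE; last exact: free_coord_bilin.
  by rewrite linearZ scale_lfunE linearZ lfunE.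
rewrite lfunPZ -es -et scaler_sumr -big_split; apply: eq_bigr => i _ /=.
by rewrite !linPZ.
Qed.

(* Expanding f(p_i) and f'(q_j) on the dual bases turns both sides into double
   sums that differ by the symmetry of l. *)
Lemma dual_basis_trace (l : 'Hom(A, k^o)) P Q (I J : finType)
    (p : I -> P) (phi : I -> homA P regMod) (q : J -> Q)
    (psi : J -> homA Q regMod) (f : homA P Q) (f' : homA Q P) :
  (forall a b, l (alg_mul a b) = l (alg_mul b a)) ->
  is_dual_basis p phi -> is_dual_basis q psi ->
  \sum_i l (phi i (f' (f (p i)))) = \sum_j l (psi j (f (f' (q j)))).
Proof.
move=> ll pphi qpsi.
transitivity (\sum_i \sum_j l (alg_mul (psi j (f (p i))) (phi i (f' (q j))))).
  apply: eq_bigr => i _; rewrite -{1}[f (p i)]qpsi !linear_sum; apply: eq_bigr => j _.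
  by rewrite /= homAE homA_regE.
rewrite exchange_big; apply: eq_bigr => j _.
rewrite -{2}[f' (q j)]pphi !linear_sum; apply: eq_bigr => i _.
by rewrite /= homAE homA_regE ll.
Qed.

End FreeModules.

(** * Dual bases of the modules [P <| X] *)

Section TensorDualBasis.
Variables (k : fieldType) (H : hopfAlg k) (A : comodAlg H).
Implicit Types (P : fdMod A) (X : rep H).
Local Notation S := (antipode H).

(* The A-linear map a (x) x |-> <p, S(a_(1)) x> a_(0): up to the isomorphism of
   A <| X with the free module on X, it is the coordinate along p. *)
Definition untwist_fun X (p : dual X) : 'Hom(A \ox X, A) :=
  tlift (fun (a : A) (x : X) => tlift (fun (b : A) (h : H) =>
    ((p : 'Hom(X, k^o)) (act X (S h) x) : k) *: b) (coact A a)).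

Lemma untwist_funE X (p : dual X) (a : A) (x : X) :
  untwist_fun p (a \ot x) = tlift (fun (b : A) (h : H) =>
    ((p : 'Hom(X, k^o)) (act X (S h) x) : k) *: b) (coact A a).
Proof.
apply: tliftE; split=> [y c u v|b c u v]; first by rewrite !lfunPZ.
by rewrite -tliftP; apply: eq_tlift => b' h; rewrite !linPZ.
Qed.

(** As [S] reverses products, acting by [a] on [b \ot x] brings out S(b_(1)) S(a_(1)) a_(2) x inside
    [p]; coassociativity then lets the antipode axiom remove S(a_(1)) a_(2). *)
Fact untwist_subproof X (p : dual X) a t :
  untwist_fun p (act (regMod A <| X) a t) =
  act (regMod A) a (untwist_fun p t).
Proof.
elim/tensor_ind: t => [b x|c s t es et]; last by rewrite !lfunPZ es et.
rewrite [act _ a _]tens_modactE tlift_hom untwist_funE [act _ _ _]lmulE.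
pose F (a0 : A) (h h' : H) : A := tlift (fun (b0 : A) (b1 : H) =>
  ((p : 'Hom(X, k^o)) (act X (S b1 * (S h * h')) x) : k) *: alg_mul a0 b0)
  (coact A b).
transitivity (tlift (fun c h' => tlift (fun a0 h => F a0 h h') (coact A c))
  (coact A a)).
  apply: eq_tlift => c h; rewrite [act _ _ b]lmulE untwist_funE tlift_coactM.
    apply: eq_tlift => a0 h1; apply: eq_tlift => b0 b1.
    by rewrite -ractM antipodeM mulrA.
  by split=> [h1 d u v|a0 d u v]; rewrite ?scalePZr // !linPZ.
have hF : trilin F.
  by split=> [a0|h h' d u v]; first split=> [h d u v|h d u v];
     rewrite -tliftP; apply: eq_tlift => b0 b1; rewrite ?alg_mulPl ?linPZ.
rewrite (tlift_coactA _ hF).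
pose G (a0 : A) : A := tlift (fun (b0 : A) (b1 : H) =>
  ((p : 'Hom(X, k^o)) (act X (S b1) x) : k) *: alg_mul a0 b0) (coact A b).
have hG : linear G.
  move=> d u v; rewrite /G -tliftP; apply: eq_tlift => b0 b1.
  by rewrite alg_mulPl scalePZr.
transitivity (G a).
  rewrite -(tlift_coact_counit hG); apply: eq_tlift => a0 h.
  have hf : linear (fun z : H => tlift (fun (b0 : A) (b1 : H) =>
      ((p : 'Hom(X, k^o)) (act X (S b1 * z) x) : k) *: alg_mul a0 b0) (coact A b)).
    by move=> d u v; rewrite -tliftP; apply: eq_tlift => b0 b1; rewrite !linPZ.
  rewrite (tlift_antipodel hf); congr (_ *: _).
  by apply: eq_tlift => b0 b1; rewrite mulr1.
have hm : linear (fun b0 : A => alg_mul a b0).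
  by move=> d u v; rewrite alg_mulPr.
rewrite (tlift_lin hm); apply: eq_tlift => b0 b1.
by rewrite (linearZ' hm).
Qed.

Definition untwist X (p : dual X) : homA (regMod A <| X) (regMod A) :=
  @mkHomA k A (regMod A <| X) (regMod A) _ (untwist_subproof p).

Lemma untwistE X (p : dual X) (a : A) (x : X) :
  untwist p (a \ot x) = tlift (fun (b : A) (h : H) =>
    ((p : 'Hom(X, k^o)) (act X (S h) x) : k) *: b) (coact A a).
Proof. exact: untwist_funE. Qed.

(** Summing over the basis of [X] gives a_(0) acting on 1 (x) S(a_(1)) x, that is a_(0) (x) a_(1)
    S(a_(2)) x, which is a (x) x by the antipode axiom. *)
Lemma dual_basis_untwist X :
  is_dual_basis (fun i : 'I_(_) => alg_one A \ot (vbasis {:X})`_i : (regMod A <| X))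
    (fun i => untwist (dual_basis i)).
Proof.
elim/tensor_ind=> [a x|c s t es et]; last first.
  rewrite -{2}es -{2}et scaler_sumr -big_split; apply: eq_bigr => i _ /=.
  by rewrite !linPZ.
transitivity (tlift (fun (b : A) (h : H) =>
    act (regMod A <| X) b (alg_one A \ot act X (S h) x)) (coact A a)).
  (* The coefficients [1] give the sum the shape required by [tlift_sum]. *)
  transitivity (\sum_i 1 *: tlift (fun (b : A) (h : H) =>
      (dual_basis i : 'Hom(X, k^o)) (act X (S h) x) *:
        act (regMod A <| X) b (alg_one A \ot (vbasis {:X})`_i)) (coact A a)).
    apply: eq_bigr => i _; rewrite untwistE scale1r.
    have hf : linear (fun b : A =>
        act (regMod A <| X) b (alg_one A \ot (vbasis {:X})`_i)) by lin_side.
    rewrite (tlift_lin hf); apply: eq_tlift => b h.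
    by rewrite (linearZ' hf).
  rewrite -tlift_sum; apply: eq_tlift => b h.
  rewrite [in RHS](coord_vbasis (memvf (act X (S h) x))).
  rewrite (bilin_sumr (@tens_bilin _ _ _)) linear_sum; apply: eq_bigr => i _.
  by rewrite scale1r linearZ dual_basisE.
transitivity (tlift (fun (b : A) (t : H) => tlift (fun h h' : H =>
    b \ot act X (h * S h') x) (comul H t)) (coact A a)).
  rewrite -tlift_coactA; last by lin_side.
  apply: eq_tlift => b h; rewrite [act _ b _]tens_modactE; apply: eq_tlift => b0 b1.
  by rewrite [act _ b0 _]lmulE alg_mulr1 ractM.
have hf : linear (fun b : A => b \ot x) by lin_side.
rewrite -[RHS](tlift_coact_counit hf); apply: eq_tlift => b h.
have hg : linear (fun z : H => b \ot act X z x) by lin_side.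
by rewrite (tlift_antipoder hg) ract1 id_lfunE.
Qed.

(** The map [tensA (gen (p i)) (idA X)] carries the expansion of [phi i m \ot x] in [regMod A <| X]
    to [P <| X]; summing over [i] recovers [m \ot x]. *)
Lemma dual_basis_tens P X (I : finType) (p : I -> P)
    (phi : I -> homA P (regMod A)) :
  is_dual_basis p phi ->
  is_dual_basis
    (fun ij : I * 'I_(\dim {:X}) => p ij.1 \ot (vbasis {:X})`_ij.2 : (P <| X))
    (fun ij => untwist (dual_basis ij.2) \oA tensA (phi ij.1) (idA X)).
Proof.
move=> pphi; elim/tensor_ind=> [m x|c s t es et]; last first.
  rewrite -{2}es -{2}et scaler_sumr -big_split; apply: eq_bigr => i _ /=.
  by rewrite !linPZ.
have hf : linear (fun m : P => m \ot x) by lin_side.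
rewrite -{2}(pphi m) -[RHS](linearE' hf) linear_sum -(pair_bigA _ (fun i j =>
  act (P <| X) ((untwist (dual_basis j) \oA tensA (phi i) (idA X)) (m \ot x))
    (p i \ot (vbasis {:X})`_j))) /=.
apply: eq_bigr => i _; rewrite (linearE' hf).
transitivity (tensA (gen (p i)) (idA X) (phi i m \ot x : regMod A <| X)).
  rewrite -[(phi i m \ot x) in RHS](dual_basis_untwist (phi i m \ot x)).
  rewrite linear_sum; apply: eq_bigr => j _ /=.
  rewrite [RHS](homAE (tensA (gen (p i)) (idA X))) [in RHS]tmapE genE act1.
  by rewrite !id_lfunE comp_lfunE tmapE id_lfunE.
by rewrite [LHS]tmapE genE id_lfunE.
Qed.

End TensorDualBasis.

(** * The pivotal element and partial traces in coordinates *)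

Section Pivot.
Variables (k : fieldType) (H : hopfAlg k) (g : pivotal H) (A : comodAlg H).
Implicit Types (M P : fdMod A) (X : rep H) (l : 'Hom(A, k^o)).
Local Notation S := (antipode H).
Local Notation gp := (piv_elt g).

Lemma antipode_piv : S gp = gp^-1.
Proof.
apply: (mulIr (piv_unit g)); rewrite mulVr ?piv_unit //.
have := antipodel gp; rewrite piv_comul piv_counit scale1r tliftE //.
by lin_side.
Qed.

Lemma antipode_pivV : S gp^-1 = gp.
Proof. by rewrite -antipode_piv (piv_antipode g) mulrK ?piv_unit. Qed.

Lemma antipode_inj : injective S.
Proof.
move=> h h' e; have := congr1 S e; rewrite !(piv_antipode g).
by move=> /(mulIr _)-/(_ _)/mulrI; apply; rewrite ?unitrV piv_unit.
Qed.

Definition contract M (X : vectType k) (p : 'Hom(X, k^o)) : 'Hom(M \ox X, M) :=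
  tlift (fun (m : M) (x : X) => (p x : k) *: m).

Lemma contractE M (X : vectType k) (p : 'Hom(X, k^o)) (m : M) (x : X) :
  contract M p (m \ot x) = (p x : k) *: m.
Proof. by apply: tliftE; split=> [y c u v|n c u v]; rewrite !linPZ. Qed.

Lemma contract_homA M N (f : homA M N) X (p : 'Hom(X, k^o)) t :
  contract N p (tensA f (idA X) t) = f (contract M p t).
Proof.
elim/tensor_ind: t => [m x|c s t es et]; last by rewrite !lfunPZ es et.
by rewrite tmapE !contractE id_lfunE linearZ.
Qed.

(** The coevaluation supplies a basis of [X] with its dual basis, and evaluating after the pivotal
    map inserts the action of [gp]: a trace over [X] weighted by [gp]. *)
Lemma ptrace_piv P X (f : homA (P <| X) (P <| X)) m :
  ptrace (tensA (idA P) (piv g X) \oA f) m =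
  \sum_(i < \dim {:X}) contract P
     ((dual_basis i : 'Hom(X, k^o)) \o act X gp)%VF (f (m \ot (vbasis {:X})`_i)).
Proof.
rewrite !compE runitV_funE tmapE id_lfunE coev_funE scale1r.
have h : linear (fun t : X \ox dual X => m \ot t) by lin_side.
rewrite /coev_elt -(linearE' h) !linear_sum; apply: eq_bigr => i _ /=.
rewrite (linearE' h) tassocVE tmapE id_lfunE comp_lfunE.
elim/tensor_ind: (f _) => [n x|c s t es et].
  rewrite contractE tmapE tassocE tmapE id_lfunE.
  transitivity (runit_fun P
    (n \ot (piv_fun g X x : 'Hom(dual X, k^o)) (dual_basis i))).
    congr (runit_fun _ (_ \ot _)); [exact: id_lfunE |].
    exact: (ev_funE (piv_fun g X x) (dual_basis i)).
  by rewrite runit_funE piv_funE comp_lfunE.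
by rewrite !linPZ es et.
Qed.

(** This writes a map into [P <| dual (dual X)] as the pivotal map after a map into [P <| X], the
    form needed by [ptrace_piv]. *)
Lemma pivK P X Y (f : homA Y (P <| dual (dual X))) :
  tensA (idA P) (piv g X) \oA (tensA (idA P) (pivV g X) \oA f) = f.
Proof.
apply: homA_eq => y; rewrite !compE -[LHS]comp_lfunE -tmap_comp comp_lfun1l.
have -> : (piv_fun g X \o (piv_fun g X)^-1)%VF = \1%VF.
  by apply/lfunP => F; rewrite comp_lfunE piv_surj id_lfunE.
by rewrite tmap1 id_lfunE.
Qed.

Lemma pivVK P X Y (f : homA Y (P <| X)) :
  tensA (idA P) (pivV g X) \oA (tensA (idA P) (piv g X) \oA f) = f.
Proof.
apply: homA_eq => y; rewrite !compE -[LHS]comp_lfunE -tmap_comp comp_lfun1l.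
have -> : ((piv_fun g X)^-1 \o piv_fun g X)%VF = \1%VF.
  by apply/lfunP => F; rewrite comp_lfunE piv_inj id_lfunE.
by rewrite tmap1 id_lfunE.
Qed.

(** Both directions of the bijection use this identity: it isolates l(a_(0)) a_(1), the left side of
    the twisted condition. *)
Lemma form_untwist l X (p : dual X) a (x : X) :
  l (untwist A p (a \ot x)) =
  (p : 'Hom(X, k^o)) (act X (S (tlift (fun (b : A) (h : H) =>
    (l b : k) *: h) (coact A a))) x).
Proof.
have hp : linear (fun h : H => (p : 'Hom(X, k^o)) (act X (S h) x)) by lin_side.
rewrite untwistE tlift_hom (tlift_lin hp); apply: eq_tlift => b h.
by rewrite (linearZ' hp) linearZ /= [LHS]mulrC.
Qed.

Lemma twisted_form_untwist l X (p : dual X) t : is_twisted_form g l ->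
  l (untwist A p t) = l (contract (regMod A) ((p : 'Hom(X, k^o)) \o act X gp)%VF t).
Proof.
move=> [_ lg]; elim/tensor_ind: t => [a x|c s t es et]; last first.
  by rewrite !lfunPZ es et.
rewrite form_untwist lg contractE !linearZ /= antipode_pivV.
by rewrite scale_lfunE linearZ comp_lfunE [LHS]mulrC.
Qed.

End Pivot.

(** * From twisted forms to modified traces *)

Section TraceOfForm.
Variables (k : fieldType) (H : hopfAlg k) (g : pivotal H) (A : comodAlg H).

(** One choice of coordinates for each [P]; by [form_traceE] the trace of a twisted form does not
    depend on it. *)
Definition proj_coord (P : projMod A) : 'I_(\dim {:P}) -> homA P (regMod A) :=
  sval (cid (projective_dual_basis (@proj_modP _ _ P))).

Lemma proj_coordP (P : projMod A) :
  is_dual_basis (fun i : 'I_(_) => (vbasis {:P})`_i) (@proj_coord P).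
Proof. exact: svalP (cid _). Qed.

Definition form_trace (l : 'Hom(A, k^o)) (P : projMod A) (f : homA P P) : k :=
  \sum_i l (proj_coord i (f (vbasis {:P})`_i)).

(** Independence of the dual basis is the case of [dual_basis_trace] where both modules are [P] and
    one map is the identity. *)
Lemma form_traceE (l : 'Hom(A, k^o)) (P : projMod A) (I : finType) (p : I -> P)
    (phi : I -> homA P (regMod A)) (f : homA P P) :
  is_twisted_form g l -> is_dual_basis p phi ->
  form_trace l f = \sum_i l (phi i (f (p i))).
Proof.
move=> [ll _] pphi.
have := dual_basis_trace f (idA P) ll (@proj_coordP P) pphi.
under eq_bigr => i _ do rewrite id_lfunE.
by under [RHS]eq_bigr => i _ do rewrite id_lfunE.
Qed.

Lemma form_trace_mtrace (l : 'Hom(A, k^o)) :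
  is_twisted_form g l -> is_mtrace g (form_trace l).
Proof.
move=> lT; split=> [P c f f'|P Q f f'|P X f].
- have ffE x : (c *: f + f') x = c *: f x + f' x by rewrite addAE scaleAE.
  rewrite /form_trace mulr_sumr -big_split; apply: eq_bigr => i _ /=.
  by rewrite ffE !linearP.
- rewrite /form_trace.
  under eq_bigr => i _ do rewrite compE.
  under [RHS]eq_bigr => i _ do rewrite compE.
  exact: dual_basis_trace lT.1 (@proj_coordP P) (@proj_coordP Q).
(* Both sides now involve the same endomorphism [f'] of [P <| X], and can be compared term by term
   on the tensor dual basis. *)
rewrite -{1}(pivK g f); set f' := _ \oA f.
rewrite (@form_traceE l (tensProj P X) _ _ _ _ lT
  (dual_basis_tens (@proj_coordP P))).
rewrite -(pair_bigA _ (fun i j => l ((untwist A (dual_basis j) \oA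
  tensA (proj_coord i) (idA X)) (f' ((vbasis {:P})`_i \ot (vbasis {:X})`_j))))).
apply: eq_bigr => i _; rewrite ptrace_piv !linear_sum; apply: eq_bigr => j _.
by rewrite [in RHS]compE (twisted_form_untwist _ _ lT) contract_homA.
Qed.

End TraceOfForm.

(** * From modified traces to twisted forms *)

Section FormOfTrace.
Variables (k : fieldType) (H : hopfAlg k) (g : pivotal H) (A : comodAlg H).
Implicit Types (t : mtrace g A).

Lemma mtrace_linear t (P : projMod A) : linear (@mtrace_fam _ _ _ _ t P : _ -> k^o).
Proof. by have [tP _ _] := mtraceP t => c u v; rewrite tP. Qed.

Lemma mtraceC t (P Q : projMod A) (f : homA P Q) (f' : homA Q P) :
  t P (f' \oA f) = t Q (f \oA f').
Proof. by have [_ -> _] := mtraceP t. Qed.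

Lemma mtrace_sum t (P : projMod A) (I : finType) (f : I -> homA P P) :
  t P (\sum_i f i) = \sum_i t P (f i).
Proof.
pose tL : {linear homA P P -> k^o} := HB.pack (@mtrace_fam _ _ _ _ t P : _ -> k^o)
  (GRing.isLinear.Build k (homA P P) k^o *:%R _ (@mtrace_linear t P)).
exact: (linear_sum tL).
Qed.

Fact form_of_mtrace_linear t :
  linear (fun a : A => t (regProj A) (gen (a : regMod A)) : k^o).
Proof.
move=> c a b; rewrite -mtrace_linear; congr (mtrace_fam t _).
by apply: homA_eq => x; rewrite addAE scaleAE !genE lfunPZ.
Qed.

Definition form_of_mtrace t : 'Hom(A, k^o) :=
  linfun (fun a : A => t (regProj A) (gen (a : regMod A)) : k^o).

Lemma form_of_mtraceE t a : form_of_mtrace t a = t (regProj A) (gen (a : regMod A)).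
Proof. by rewrite /form_of_mtrace (linearE' (@form_of_mtrace_linear t)). Qed.

Lemma mtrace_dual_basis t (P : projMod A) (I : finType) (p : I -> P)
    (phi : I -> homA P (regMod A)) (f : homA P P) :
  is_dual_basis p phi -> t P f = \sum_i form_of_mtrace t (phi i (f (p i))).
Proof.
move=> pphi.
have {1}-> : f = \sum_i (gen (f (p i)) \oA phi i).
  apply: homA_eq => x; rewrite sumAE -{1}(pphi x) linear_sum.
  by apply: eq_bigr => i _; rewrite [RHS]compE genE -homAE.
rewrite mtrace_sum; apply: eq_bigr => i _.
(* Each summand factors through [A], so cyclicity moves its trace to an endomorphism of [A]. *)
by rewrite (@mtraceC t P (regProj A)) comp_gen form_of_mtraceE.
Qed.

Lemma untwist1 X (p : dual X) (x : X) :
  untwist A p (alg_one A \ot x) = ((p : 'Hom(X, k^o)) x : k) *: alg_one A.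
Proof.
rewrite untwistE coact1 tliftE; first by rewrite antipode1 ract1 id_lfunE.
by split=> [h c u v|b c u v]; rewrite !linPZ.
Qed.

(* The partial trace property for the rank-one endomorphism
   u |-> untwist p u . (a (x) x) of A <| X, whose trace is found by cyclicity. *)
Lemma form_of_mtrace_untwist t X (p : dual X) a (x : X) :
  form_of_mtrace t (untwist A p (a \ot x)) =
  ((p : 'Hom(X, k^o)) (act X (piv_elt g) x) : k) *: form_of_mtrace t a.
Proof.
pose f := gen (a \ot x : regMod A <| X) \oA untwist A p.
have fE i : f (alg_one A \ot (vbasis {:X})`_i) =
    ((p : 'Hom(X, k^o)) (vbasis {:X})`_i : k) *: (a \ot x).
  rewrite /f [LHS]compE genE untwist1 linearZ [LHS]scale_lfunE.
  by congr (_ *: _); exact: act1E.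
have [_ _ /(_ (regProj A) X (tensA (idA _) (piv g X) \oA f))] := mtraceP t.
rewrite pivVK [in RHS](@mtraceC t (tensProj (regProj A) X) (regProj A)) comp_gen.
rewrite -form_of_mtraceE => <-.
(* The partial trace is an endomorphism of [A], hence right multiplication by its value at the
   unit. *)
rewrite [ptrace _]homA_gen -form_of_mtraceE ptrace_piv -linearZ; congr (_ _).
transitivity (\sum_(i < \dim {:X})
  (((p : 'Hom(X, k^o)) (vbasis {:X})`_i : k) *
    (dual_basis i : 'Hom(X, k^o)) (act X (piv_elt g) x)) *: a).
  apply: eq_bigr => i _; rewrite fE -scalerA [LHS]linearZ; congr (_ *: _).
  by rewrite [LHS]contractE comp_lfunE.
rewrite -scaler_suml; congr (_ *: _).
rewrite [in RHS](coord_vbasis (memvf (act X (piv_elt g) x))) linear_sum.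
by apply: eq_bigr => i _; rewrite linearZ dual_basisE mulrC.
Qed.

Lemma form_of_mtrace_twisted t : is_twisted_form g (form_of_mtrace t).
Proof.
(* Right multiplications compose in reverse order, so symmetry of the form is cyclicity of the trace
   on [A]. *)
have genM a b : gen (alg_mul a b : regMod A) = gen (b : regMod A) \oA gen (a : regMod A).
  by rewrite comp_gen genE lmulE.
split=> [a b|a].
  by rewrite !form_of_mtraceE !genM (@mtraceC t (regProj A) (regProj A)).
set r := tlift _ _; apply: (antipode_inj g).
(* In the regular module an element of [H] is recovered from its action on [1], and linear
   functionals separate elements. *)
pose X : rep H := regMod (regular_comodAlg H).
have actE (h : H) : act X h (1 : H) = h by rewrite [LHS]lmulE; apply: mulr1.
have rE (p : dual X) : (p : 'Hom(X, k^o)) (antipode H r) =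
    (form_of_mtrace t a : k) *: (p : 'Hom(X, k^o)) (piv_elt g).
  have := form_of_mtrace_untwist t p a (1 : H).
  by rewrite form_untwist -/r !actE => ->; apply: mulrC.
rewrite linearZ /= antipode_pivV.
rewrite [LHS](coord_vbasis (memvf _)) [RHS](coord_vbasis (memvf _)).
apply: eq_bigr => i _; congr (_ *: _); rewrite linearZ.
by have := rE (@dual_basis k H X i); rewrite !dual_basisE.
Qed.

End FormOfTrace.

(** * The two constructions are mutually inverse *)

Theorem theorem7p5 (k : fieldType) (H : hopfAlg k) (g : pivotal H)
    (A : comodAlg H) :
  exists F : mtrace g A -> twisted_form g A,
    bijective F /\
    forall (c : k) (s t : mtrace g A), F (mtrace_lin c s t) = c *: F s + F t.
Proof.
pose F (t : mtrace g A) : twisted_form g A :=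
  TwistedForm (asboolT (form_of_mtrace_twisted t)
    : form_of_mtrace t \in @twisted_form_pred k H g A).
pose G (l : twisted_form g A) : mtrace g A :=
  MTrace (form_trace_mtrace (asboolW (twisted_formP l))).
exists F; split; last first.
  move=> c s t; apply: val_inj; apply/lfunP => a.
  by rewrite [RHS]add_lfunE scale_lfunE !form_of_mtraceE.
exists G => [[t tP]|l].
  have Gt : form_trace (form_of_mtrace (MTrace tP)) = t.
    apply/functional_extensionality_dep => P; apply/funext => f.
    exact: esym (mtrace_dual_basis (MTrace tP) f (@proj_coordP _ _ _ P)).
  (* The proof stored in the record depends on the family, so it is generalized before the family is
     rewritten; proof irrelevance then concludes. *)
  rewrite /G /=; move: (form_trace_mtrace _); rewrite Gt => tP'.
  by congr MTrace; apply: Prop_irrelevance.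
apply: val_inj; apply/lfunP => a; rewrite [LHS]form_of_mtraceE.
(* On [A] the chosen dual basis is traded for the one-element basis formed by the unit and the
   identity, leaving the single term [l a]. *)
rewrite [LHS](@form_traceE _ _ _ _ _ (regProj A) _ _ _ _
  (asboolW (twisted_formP l)) (@dual_basis_regMod _ A)).
rewrite (big_pred1 tt) => [|[] //]; congr (l _).
by rewrite [LHS]id_lfunE [LHS]genE [LHS]lmulE alg_mul1.
Qed.
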